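(* Let $n\geq 1$ and let $\mathcal{N}:L_n([0,1])\to L_n([0,1])$ be an $n$-dimensional fuzzy negation. Then $\mathcal{N}$ is $n$-representable if and only if $\mathcal{N}$ is $\subseteq$-monotone.
   Context: $L_n([0,1])=\{(x_1,\ldots,x_n)\in[0,1]^n : x_1\leq\cdots\leq x_n\}$, with projections $\pi_i(x_1,\ldots,x_n)=x_i$ and the componentwise order: $\mathbf{x}\leq\mathbf{y}$ iff $\pi_i(\mathbf{x})\leq\pi_i(\mathbf{y})$ for all $i$. For $x\in[0,1]$, $/x/=(x,\ldots,x)\in L_n([0,1])$. A fuzzy negation is a function $N:[0,1]\to[0,1]$ with $N(0)=1$, $N(1)=0$ and $N(x)\geq N(y)$ whenever $x\leq y$. An $n$-dimensional fuzzy negation is a function $\mathcal{N}:L_n([0,1])\to L_n([0,1])$ with $\mathcal{N}(/0/)=/1/$, $\mathcal{N}(/1/)=/0/$ and $\mathcal{N}(\mathbf{x})\geq\mathcal{N}(\mathbf{y})$ whenever $\mathbf{x}\leq\mathbf{y}$. For fuzzy negations $N_1\leq\cdots\leq N_n$ (pointwise), $\widetilde{N_1\ldots N_n}(\mathbf{x})=(N_1(\pi_n(\mathbf{x})),N_2(\pi_{n-1}(\mathbf{x})),\ldots,N_n(\pi_1(\mathbf{x})))$, i.e. the $i$-th component is $N_i(\pi_{n-i+1}(\mathbf{x}))$. $\mathcal{N}$ is $n$-representable if there exist fuzzy negations $N_1\leq\cdots\leq N_n$ with $\mathcal{N}=\widetilde{N_1\ldots N_n}$. For $i=1,\ldots,n-1$,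 $\mathbf{x}\subseteq_i\mathbf{y}$ means $\pi_i(\mathbf{y})\leq\pi_i(\mathbf{x})\leq\pi_{i+1}(\mathbf{x})\leq\pi_{i+1}(\mathbf{y})$. $\mathcal{N}$ is $\subseteq_i$-monotone if for all $\mathbf{x},\mathbf{y}\in L_n([0,1])$, $\mathbf{x}\subseteq_{n-i}\mathbf{y}$ implies $\mathcal{N}(\mathbf{x})\subseteq_i\mathcal{N}(\mathbf{y})$. $\mathcal{N}$ is $\subseteq$-monotone if it is $\subseteq_i$-monotone for every $i=1,\ldots,n-1$. *)

(* Defs.v *)
From HB Require Import structures.
From mathcomp Require Import all_boot all_order all_algebra.
From mathcomp Require Import zify interval_inference reals.

Set Implicit Arguments.
Unset Strict Implicit.
Unset Printing Implicit Defensive.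

Import Order.TTheory GRing.Theory Num.Theory.

Local Open Scope ring_scope.

Record Ln (R : realType) (n : nat) := MkLn {
  Ln_val :> n.-tuple {i01 R};
  Ln_sorted : sorted <=%O Ln_val }.

HB.instance Definition _ (R : realType) (n : nat) := [isSub for @Ln_val R n].
HB.instance Definition _ (R : realType) (n : nat) := [Equality of Ln R n by <:].

(* Projections are numbered from 1: [Lproj k x] is the k-th component for
   [1 <= k <= n]; its values for other k are irrelevant. *)
Definition Lproj (R : realType) (n : nat) (k : nat) (x : Ln R n) : {i01 R} :=
  nth 0%:i01 x k.-1.

Definition Ln_le (R : realType) (n : nat) (x y : Ln R n) : Prop :=
  forall i : nat, (1 <= i <= n)%N -> Lproj i x <= Lproj i y.

Lemma diag_sorted (R : realType) (n : nat) (a : {i01 R}) :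
  sorted <=%O [tuple of nseq n a].
Proof.
by case: n => [//|n] /=; elim: n => [//|n IHn] /=; rewrite lexx.
Qed.

(* The degenerate element /a/ = (a, ..., a). *)
Definition diag (R : realType) (n : nat) (a : {i01 R}) : Ln R n :=
  MkLn (diag_sorted n a).

Definition fuzzy_negation (R : realType) (N : {i01 R} -> {i01 R}) : Prop :=
  [/\ N 0%:i01 = 1%:i01, N 1%:i01 = 0%:i01 &
      forall x y : {i01 R}, x <= y -> N y <= N x].

Definition ndim_fuzzy_negation (R : realType) (n : nat)
    (NN : Ln R n -> Ln R n) : Prop :=
  [/\ NN (diag n 0%:i01) = diag n 1%:i01,
      NN (diag n 1%:i01) = diag n 0%:i01 &
      forall x y : Ln R n, Ln_le x y -> Ln_le (NN y) (NN x)].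

(* A family N_1 <= ... <= N_n of fuzzy negations; [N i] with [i : 'I_n] is
   N_(i+1). *)
Definition negation_chain (R : realType) (n : nat)
    (N : 'I_n -> {i01 R} -> {i01 R}) : Prop :=
  (forall i : 'I_n, fuzzy_negation (N i)) /\
  (forall i j : 'I_n, (i <= j)%N -> forall a : {i01 R}, N i a <= N j a).

(* The entry at the zero-based position [i] is the (i+1)-th component, namely
   N_(i+1) (pi_(n-(i+1)+1) x). *)
Definition tilde_val (R : realType) (n : nat)
    (N : 'I_n -> {i01 R} -> {i01 R}) (x : Ln R n) : n.-tuple {i01 R} :=
  [tuple N i (Lproj (n - i) x) | i < n].

Lemma tilde_sorted (R : realType) (n : nat)
    (N : 'I_n -> {i01 R} -> {i01 R}) (hN : negation_chain N) (x : Ln R n) :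
  sorted <=%O (tilde_val N x).
Proof.
case: hN => hN hle.
apply/(sortedP 0%:i01) => i; rewrite size_tuple => hi.
have hi' := ltnW hi.
rewrite -[i]/(nat_of_ord (Ordinal hi')) -[i.+1]/(nat_of_ord (Ordinal hi)).
rewrite -!tnth_nth !tnth_mktuple /=.
apply: (le_trans (hle _ (Ordinal hi) _ _)) => //=.
case: (hN (Ordinal hi)) => _ _; apply; rewrite /Lproj.
have lex := @le_refl _ {i01 R}; have ltx := @le_trans _ {i01 R}.
apply: (sorted_leq_nth ltx lex _ (Ln_sorted x)).
- by rewrite inE size_tuple; lia.
- by rewrite inE size_tuple; lia.
- by lia.
Qed.

Definition tilde (R : realType) (n : nat) (N : 'I_n -> {i01 R} -> {i01 R})
    (hN : negation_chain N) (x : Ln R n) : Ln R n :=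
  MkLn (tilde_sorted hN x).

Definition representable (R : realType) (n : nat)
    (NN : Ln R n -> Ln R n) : Prop :=
  exists (N : 'I_n -> {i01 R} -> {i01 R}) (hN : negation_chain N),
    NN =1 tilde hN.

Definition sub_at (R : realType) (n : nat) (i : nat) (x y : Ln R n) : Prop :=
  [/\ Lproj i y <= Lproj i x, Lproj i x <= Lproj i.+1 x &
      Lproj i.+1 x <= Lproj i.+1 y].

Definition sub_at_monotone (R : realType) (n : nat) (i : nat)
    (NN : Ln R n -> Ln R n) : Prop :=
  forall x y : Ln R n, sub_at (n - i) x y -> sub_at i (NN x) (NN y).

Definition sub_monotone (R : realType) (n : nat)
    (NN : Ln R n -> Ln R n) : Prop :=
  forall i : nat, (1 <= i <= n.-1)%N -> sub_at_monotone i NN.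

(* Main.v *)
Require Import Defs.
From mathcomp Require Import all_boot all_order all_algebra.
From mathcomp Require Import zify interval_inference reals.

(** Write [a] for the [n-i+1]-th component of [x]; everything rests on the
    identity [pi_i (N x) = pi_i (N /a/)].  The degenerate element [/a/] is
    included in [x] both for [sub_(n-i)] and for [sub_(n-i+1)]: the former bounds
    [pi_i (N x)] from above by [pi_i (N /a/)], the latter from below.  When
    [i = n] (resp. [i = 1]) the missing inclusion is replaced by [/a/ <= x]
    (resp. [x <= /a/]) and antitonicity. *)

Set Implicit Arguments.
Unset Strict Implicit.
Unset Printing Implicit Defensive.

Import Order.TTheory GRing.Theory Num.Theory.

Local Open Scope ring_scope.

Section Projections.
Variables (R : realType) (n : nat).
Implicit Types (x y : Ln R n) (a : {i01 R}) (NN : Ln R n -> Ln R n).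

Lemma Lproj_mono x (j k : nat) :
  (1 <= j)%N -> (j <= k <= n)%N -> Lproj j x <= Lproj k x.
Proof.
move=> j1 /andP[jk kn]; rewrite /Lproj.
have lex := @le_refl _ {i01 R}; have ltx := @le_trans _ {i01 R}.
by apply: (sorted_leq_nth ltx lex _ (Ln_sorted x));
  rewrite ?inE ?size_tuple; lia.
Qed.

Lemma Lproj_diag a (k : nat) : (1 <= k <= n)%N -> Lproj k (diag n a) = a.
Proof. by move=> kn; rewrite /Lproj /= nth_nseq ifT //; lia. Qed.

Lemma Ln_ext x y :
  (forall k, (1 <= k <= n)%N -> Lproj k x = Lproj k y) -> x = y.
Proof.
move=> xy; apply/val_inj/eq_from_tnth => i /=.
by rewrite !(tnth_nth 0%:i01); apply: (xy i.+1); have := ltn_ord i; lia.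
Qed.

Lemma Lproj_tilde (N : 'I_n -> {i01 R} -> {i01 R}) (hN : negation_chain N)
    x (i : 'I_n) :
  Lproj i.+1 (tilde hN x) = N i (Lproj (n - i) x).
Proof.
exact: etrans (esym (tnth_nth _ (tilde_val N x) i)) (tnth_mktuple _ _).
Qed.

(** With [k] equal to [j] or [j.+1], the repeated value is an endpoint of the interval that [x]
    spans between these two positions. *)
Lemma diag_sub_at x (j k : nat) :
  (1 <= j < n)%N -> (j <= k <= j.+1)%N -> sub_at j (diag n (Lproj k x)) x.
Proof. by move=> jn kj; split; rewrite ?Lproj_diag ?Lproj_mono //; lia. Qed.

(** Each [N i] is antitone and the positions are reversed, so the lower-end inequality of the
    hypothesis yields the upper-end one of the conclusion, and vice versa. The middle inequality is
    sortedness. *)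
Lemma tilde_sub_monotone (N : 'I_n -> {i01 R} -> {i01 R})
    (hN : negation_chain N) : sub_monotone (tilde hN).
Proof.
move=> [//|i] /andP[_ lin] x y [yx _ xy].
have hi : (i < n)%N by lia.
have hi1 : (i.+1 < n)%N by lia.
split; last 1 first.
- rewrite !(Lproj_tilde hN _ (Ordinal hi1)) /=.
  by case: (hN.1 (Ordinal hi1)) => _ _; apply.
- rewrite !(Lproj_tilde hN _ (Ordinal hi)) /=.
  case: (hN.1 (Ordinal hi)) => _ _; apply.
  by have -> : (n - i = (n - i.+1).+1)%N by lia.
- by apply: Lproj_mono; lia.
Qed.

Lemma sub_monotone_Lproj NN x (i : nat) :
    ndim_fuzzy_negation NN -> sub_monotone NN -> (i < n)%N ->
  Lproj i.+1 (NN x) = Lproj i.+1 (NN (diag n (Lproj (n - i) x))).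
Proof.
move=> [_ _ anti] mono lin; set d := diag n _.
have i1n : (1 <= i.+1 <= n)%N by lia.
apply/le_anti/andP; split.
- have [ni|ni] := eqVneq i.+1 n.
    (* Here [n - i] is 1, so [d] repeats the least component of [x]. *)
    apply: (anti d x) => // k kn.
    by rewrite Lproj_diag // Lproj_mono //; lia.
  have /mono mi : (1 <= i.+1 <= n.-1)%N by lia.
  have /mi[] // : sub_at (n - i.+1) d x by apply: diag_sub_at; lia.
- case: i lin @d i1n => [|i] lin d i1n.
    apply: (anti x d) => // k kn.
    by rewrite Lproj_diag // Lproj_mono //; lia.
  (* The component under study is now [i.+2], the upper end of the inclusion at [i.+1]; [d] repeats
     the lower of the two components of [x] involved. *)
  have /mono mi : (1 <= i.+1 <= n.-1)%N by lia.
  have /mi[] // : sub_at (n - i.+1) d x by apply: diag_sub_at; lia.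
Qed.

(** The only possible representing family: evaluating a representation at [diag n a] forces these
    values. *)
Definition diag_family NN (i : 'I_n) a : {i01 R} := Lproj i.+1 (NN (diag n a)).

Lemma diag_family_chain NN :
  ndim_fuzzy_negation NN -> negation_chain (diag_family NN).
Proof.
move=> [NN0 NN1 anti]; split=> [i|i j ij a]; rewrite /diag_family.
- have hi : (1 <= i.+1 <= n)%N by have := ltn_ord i; lia.
  split=> [||a b ab]; rewrite ?NN0 ?NN1 ?Lproj_diag //.
  by apply: anti hi => k kn; rewrite !Lproj_diag.
(* The family is ordered because the single tuple [NN (diag n a)] is sorted. *)
- by apply: Lproj_mono => //; have := ltn_ord j; lia.
Qed.

End Projections.

Theorem theorem10 (R : realType) (n : nat) (hn : (1 <= n)%N)
    (NN : Ln R n -> Ln R n) (hNN : ndim_fuzzy_negation NN) :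
  representable NN <-> sub_monotone NN.
Proof.
split=> [[N [hN NNE]] i hi x y|mono].
  by rewrite !NNE; exact: tilde_sub_monotone.
exists (diag_family NN), (diag_family_chain hNN) => x.
apply: Ln_ext => -[//|k] /andP[_ kn].
by rewrite (Lproj_tilde _ x (Ordinal kn)) /diag_family -sub_monotone_Lproj.
Qed.
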